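(* The stochastic resonance point of the diffusion $X$ with time-periodic potential $U$ and the stochastic resonance point of the two-state Markov chain $Y$ with exponential transition rate functions $D_{\pm1}$ coincide (if one of them exists, so does the other, and they are equal).
   Context: Potential: $U:\mathbb{R}_+\times\mathbb{R}\to\mathbb{R}$, $(t,x)\mapsto U(t,x)$, is 1-periodic in $t$, differentiable in $x$, and $\frac{\partial U}{\partial x}$ is continuous in $(t,x)$. For every $t$ the critical points of $U(t,\cdot)$ are exactly $-1,0,1$; $\pm1$ are local minima and $0$ is the saddle (local maximum) separating them. There are constants $K_1,K_2>0$ with $\sup_{t\ge0}\frac{\partial U}{\partial x}(t,x)\le -K_2$ for $x\le -K_1$ and $\inf_{t\ge0}\frac{\partial U}{\partial x}(t,x)\ge K_2$ for $x\ge K_1$. Depth functions: $D_{i}(t)=U(t,0)-U(t,i)$, $i=\pm1$ (1-periodic in $t$). It is assumed that all local extrema of $D_1$ and $D_{-1}$ are global and that these functions are strictly monotone between their extrema; that $D_1$ and $D_{-1}$ differ by a phase, $D_1(t)=D_{-1}(t+\phi)$ for some $\phi\in\,]0,1[$; and that $D_i(0)>\inf_{t\ge0}\max_{j=\pm1}D_j(t)$ for $i=\pm1$. For $\mu\ge0$, $a^i_\mu=\inf\{t\ge0:D_i(t)\le\mu\}$, $i=\pm1$. The resonance interval is $I_R=\left]\max_{i=\pm1}\inf_{t\ge0}D_i(t),\ \inf_{t\ge0}\max_{i=\pm1}D_i(t)\right[$. Throughout $T=\exp(\mu/\varepsilon)$. Diffusion: $X$ solves $dX_t=-\frac{\partial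 U}{\partial x}\left(\frac tT,X_t\right)dt+\sqrt{2\varepsilon}\,dW_t$, $W$ a Brownian motion. Its resonance point: suppose that (for small $h>0$) the function $I_R\ni\mu\mapsto\max_{i=\pm1}\{\mu-D_i(a^i_\mu-h)\}$ possesses a global minimum, attained at $\mu_R(h)$, and that $\mu_R=\lim_{h\to0}\mu_R(h)$ exists in $I_R$; then $\mu_R$ is the stochastic resonance point of $X$. (The minimized function is the exponential rate $\lim_{\varepsilon\to0}\varepsilon\ln(1-M(\varepsilon,\mu))$ of the quality measure $M(\varepsilon,\mu)=\min_{i=\pm1}\mathbb{P}_i(\tau_{-i}(X)\in[(a^i_\mu-h)T,(a^i_\mu+h)T])$, where $\tau_a(X)$ is the first hitting time of $a$ and $\mathbb{P}_i$ is the law with $X_0=i$.) Markov chain: $Y$ is the continuous-time, time-inhomogeneous Markov chain on $\{-1,1\}$ which at time $t$ jumps from $-1$ to $1$ at rate $\exp(-D_{-1}(t/T)/\varepsilon)$ and from $1$ to $-1$ at rate $\exp(-D_{1}(t/T)/\varepsilon)$. Let $\sigma_{j}(Y)$ be the first time $Y$ reaches state $j$, let $\mathbb{P}_i$ also denote the law with $Y_0=i$, and let $N(\varepsilon,\mu)=\min_{i=\pm1}\mathbb{P}_i(\sigma_{-i}(Y)\in[(a^i_\mu-h)T,(a^i_\mu+h)T])$. The stochastic resonance point of $Y$ is defined just as for $X$: for small $h>0$ minimize the exponential rate $\mu\mapsto\lim_{\varepsilon\to0}\varepsilon\ln(1-N(\varepsilon,\mu))$ over $\mu\in I_R$, and let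 $h\to0$ in the minimizer; if the minimizer exists and the limit exists in $I_R$, this limit is the stochastic resonance point of $Y$. *)

(* Defs.v *)
From HB Require Import structures.
From mathcomp Require Import all_boot all_order all_algebra.
From mathcomp Require Import all_classical all_reals all_analysis.

Set Implicit Arguments.
Unset Strict Implicit.
Unset Printing Implicit Defensive.

Import Order.TTheory GRing.Theory Num.Theory.
Import numFieldTopology.Exports numFieldNormedType.Exports.

Local Open Scope classical_set_scope.
Local Open Scope ring_scope.

(* Time ranges over the nonnegative reals: a function of time has type R -> _
   and is only ever constrained at arguments t >= 0.  The labels i of the two
   wells are the real numbers 1 and -1, so that the well opposite to i is - i. *)

Section Extrema.
Variable R : realType.

Definition is_well (i : R) : Prop := i = 1 \/ i = -1.

Definition local_min (f : R -> R) (x : R) : Prop := \forall y \near x, f x <= f y.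
Definition local_max (f : R -> R) (x : R) : Prop := \forall y \near x, f y <= f x.

(* Only t > 0 is tested.  For a 1-periodic function no extremum is lost (t = 0
   is represented by t = 1), and the endpoint 0 of the half-line is not counted
   as an extremum merely because it is an endpoint. *)
Definition local_extrema_are_global (f : R -> R) : Prop :=
  forall t : R, 0 < t ->
    (local_max f t -> forall s : R, 0 <= s -> f s <= f t) /\
    (local_min f t -> forall s : R, 0 <= s -> f t <= f s).

Definition strictly_monotone_between_extrema (f : R -> R) : Prop :=
  forall s t : R, 0 <= s -> s < t ->
    (forall r, s < r < t -> ~ (local_max f r \/ local_min f r)) ->
    {in `[s, t] &, {homo f : x y / x < y}} \/
    {in `[s, t] &, {homo f : x y /~ x < y}}.

End Extrema.

Section Potential.
Variable R : realType.
Variable U : R -> R -> R.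

Record double_well_potential : Prop := DoubleWellPotential {
  potential_periodic : forall t x : R, 0 <= t -> U (t + 1) x = U t x ;
  potential_derivable : forall t x : R, 0 <= t -> derivable (U t) x 1 ;
  potential_C1 : {within [set p : R * R | 0 <= p.1],
                    continuous (fun p : R * R => derive1 (U p.1) p.2)} ;
  potential_critical : forall t x : R, 0 <= t ->
    derive1 (U t) x = 0 <-> [\/ x = -1, x = 0 | x = 1] ;
  potential_wells : forall t : R, 0 <= t ->
    local_min (U t) (-1) /\ local_min (U t) 1 ;
  potential_saddle : forall t : R, 0 <= t -> local_max (U t) 0 ;
  potential_growth : exists K1 K2 : R, [/\ 0 < K1, 0 < K2,
    forall x : R, x <= - K1 -> forall t : R, 0 <= t -> derive1 (U t) x <= - K2 &
    forall x : R, K1 <= x -> forall t : R, 0 <= t -> K2 <= derive1 (U t) x] }.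

Definition depth (i t : R) : R := U t 0 - U t i.

Definition inf_time (f : R -> R) : R := inf (f @` [set t | 0 <= t]).

Definition inf_max_depth : R :=
  inf_time (fun t => Num.max (depth 1 t) (depth (-1) t)).

Record depth_assumptions : Prop := DepthAssumptions {
  depth_extrema : forall i, is_well i -> local_extrema_are_global (depth i) ;
  depth_monotone : forall i, is_well i ->
    strictly_monotone_between_extrema (depth i) ;
  depth_phase : exists phi : R, 0 < phi < 1 /\
    forall t : R, 0 <= t -> depth 1 t = depth (-1) (t + phi) ;
  depth_start : forall i, is_well i -> inf_max_depth < depth i 0 }.

Definition entrance_time (mu i : R) : R :=
  inf [set t | 0 <= t /\ depth i t <= mu].

Definition resonance_interval : set R :=
  [set` `]Num.max (inf_time (depth 1)) (inf_time (depth (-1))),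
          inf_max_depth[ ].

(* [rate h mu] is the exponential rate with window size h.  The minimum over the
   resonance interval is attained at [m h] for all small h > 0. *)
Definition is_resonance_point (rate : R -> R -> R) (muR : R) : Prop :=
  exists m : R -> R,
    [/\ \forall h \near 0^'+, resonance_interval (m h) /\
          forall mu, resonance_interval mu -> rate h (m h) <= rate h mu,
        m h @[h --> 0^'+] --> muR &
        resonance_interval muR].

(* The resonance point of the diffusion
     dX_t = - (d/dx U)(t/T, X_t) dt + sqrt(2 eps) dW_t,   T = exp(mu/eps),
   is by definition obtained by minimizing this explicit function of U. *)
Definition diffusion_rate (h mu : R) : R :=
  Num.max (mu - depth 1 (entrance_time mu 1 - h))
          (mu - depth (-1) (entrance_time mu (-1) - h)).

Definition diffusion_resonance_point (muR : R) : Prop :=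
  is_resonance_point diffusion_rate muR.

Definition period (eps mu : R) : R := expR (mu / eps).

(* Rate at which the chain leaves state i at time t. *)
Definition jump_rate (eps mu i t : R) : R :=
  expR (- depth i (t / period eps mu) / eps).

End Potential.

Section TwoStateChain.
Variable R : realType.

(* Infinitesimal generator of the chain that leaves state i at rate [q i t]. *)
Definition generator (q : R -> R -> R) (t i j : R) : R :=
  if j == i then - q i t else q i t.

(* [p s t i j] is the probability to be in j at time t given i at time s; the
   last field is Kolmogorov's forward equation d/dt p(s,t) = p(s,t) Q(t). *)
Record transition_function (q : R -> R -> R) (p : R -> R -> R -> R -> R) : Prop :=
  TransitionFunction {
  transition_ge0 : forall s t i j : R, 0 <= s -> s <= t ->
    is_well i -> is_well j -> 0 <= p s t i j ;
  transition_sum1 : forall s t i : R, 0 <= s -> s <= t ->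
    is_well i -> p s t i 1 + p s t i (-1) = 1 ;
  transition_id : forall s i j : R, 0 <= s -> is_well i -> is_well j ->
    p s s i j = (i == j)%:R ;
  transition_cvg : forall s i j : R, 0 <= s -> is_well i -> is_well j ->
    p s t i j @[t --> s^'+] --> p s s i j ;
  transition_forward : forall s t i j : R, 0 <= s -> s < t ->
    is_well i -> is_well j ->
    is_derive t 1 (fun u : R => p s u i j)
      (p s t i 1 * generator q t 1 j + p s t i (-1) * generator q t (-1) j) }.

Context {d : measure_display} {Omega : measurableType d}.

(* The event that the process takes the value c.2 at time c.1, for every c in
   the list [past]. *)
Definition cylinder (Y : R -> Omega -> R) (past : seq (R * R)) : set Omega :=
  [set w | forall c, c \in past -> Y c.1 w = c.2].

Record markov_process (P : probability Omega R) (Y : R -> Omega -> R)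
    (p : R -> R -> R -> R -> R) (i0 : R) : Prop := MarkovProcess {
  process_measurable : forall t : R, 0 <= t -> measurable_fun setT (Y t) ;
  process_state : forall (t : R) (w : Omega), 0 <= t -> is_well (Y t w) ;
  process_right_continuous : forall (t : R) (w : Omega), 0 <= t ->
    \forall u \near t^'+, Y u w = Y t w ;
  process_start : P [set w | Y 0 w = i0] = 1%:E ;
  process_markov : forall (past : seq (R * R)) (s t i j : R),
    0 <= s -> s <= t -> is_well i -> is_well j ->
    (forall c, c \in past -> 0 <= c.1 <= s) ->
    P (cylinder Y (rcons (rcons past (s, i)) (t, j))) =
      (P (cylinder Y (rcons past (s, i))) * (p s t i j)%:E)%E }.

Definition two_state_chain (P : probability Omega R) (Y : R -> Omega -> R)
    (q : R -> R -> R) (i0 : R) : Prop :=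
  exists p, transition_function q p /\ markov_process P Y p i0.

Definition hitting_time (Y : R -> Omega -> R) (j : R) (w : Omega) : \bar R :=
  ereal_inf [set t%:E | t in [set t : R | 0 <= t /\ Y t w = j]].

(* [P eps mu i] is the law of the chain started in i, for noise intensity eps
   and period exp(mu/eps); [Y eps mu] is the chain with these parameters. *)
Variables (U : R -> R -> R) (P : R -> R -> R -> probability Omega R)
  (Y : R -> R -> R -> Omega -> R).

Definition window_probability (h eps mu i : R) : R :=
  let a := entrance_time U mu i in
  let T := period eps mu in
  fine (P eps mu i [set w |
    (((a - h) * T)%:E <= hitting_time (Y eps mu) (- i) w)%E /\
    (hitting_time (Y eps mu) (- i) w <= ((a + h) * T)%:E)%E]).

Definition chain_quality (h eps mu : R) : R :=
  Num.min (window_probability h eps mu 1) (window_probability h eps mu (-1)).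

Definition chain_log_error (h mu eps : R) : R :=
  eps * ln (1 - chain_quality h eps mu).

Definition chain_rate (h mu : R) : R :=
  lim (chain_log_error h mu eps @[eps --> 0^'+]).

(* The first conjunct makes [chain_rate] meaningful: [lim] is a junk value when
   the limit does not exist. *)
Definition chain_resonance_point (muR : R) : Prop :=
  (\forall h \near 0^'+, forall mu, resonance_interval U mu ->
     cvg (chain_log_error h mu eps @[eps --> 0^'+])) /\
  is_resonance_point U chain_rate muR.

End TwoStateChain.

(* Main.v *)
(** The time [a] := [entrance_time U mu i] and the scale [T = exp (mu / eps)] are
    such that the jump rates, measured in units of [1 / T], are
    [exp ((mu - D_i) / eps)]: exponentially small before [a], exponentially
    large soon after [a].  The local minima of [D_i] being global,
    [mu > inf D_i] forces [D_i] to be minimal at [a - h] over [[0, a - h]] for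
    small [h] (uniformly in [mu]) and to drop below [mu] within [(a, a + h)].  So
    jumping too late has doubly exponentially small probability, jumping too
    early has probability [exp ((mu - D_i (a - h) + o(1)) / eps)], and the rate
    of the chain is the function whose minimizer defines the resonance point of
    the diffusion. *)
Require Import Defs.
From HB Require Import structures.
From mathcomp Require Import all_boot all_order all_algebra.
From mathcomp Require Import all_classical all_reals all_analysis.
From mathcomp Require Import ring lra.
Import Order.TTheory GRing.Theory Num.Theory.
Local Open Scope ring_scope.

Set Implicit Arguments.
Unset Strict Implicit.
Unset Printing Implicit Defensive.
Import numFieldTopology.Exports numFieldNormedType.Exports.
Local Open Scope classical_set_scope.

(** * Transition probabilities over short times *)

Section TransitionBounds.
Variable R : realType.

Lemma is_wellN (i : R) : is_well i -> is_well (- i).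
Proof. by case=> ->; [right | left; rewrite opprK]. Qed.

Lemma well_oppE (i : R) : is_well i -> (- i == i) = false.
Proof. by case=> ->; apply/negbTE/eqP => h; lra. Qed.

Variables (q : R -> R -> R) (p : R -> R -> R -> R -> R).
Hypothesis tp : transition_function q p.

Lemma transition_sum (s t i : R) : 0 <= s -> s <= t -> is_well i ->
  p s t i i + p s t i (- i) = 1.
Proof.
move=> s0 st wi; have := transition_sum1 tp s0 st wi.
by case: wi => ->; rewrite ?opprK // addrC.
Qed.

Lemma transition_stay_le1 (s t i : R) : 0 <= s -> s <= t -> is_well i ->
  p s t i i <= 1.
Proof.
move=> s0 st wi; rewrite -(transition_sum s0 st wi) lerDl.
exact: (transition_ge0 tp s0 st wi (is_wellN wi)).
Qed.

(** With two states the sum rule eliminates the off-diagonal entry, so the forward equation becomes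
    a scalar one. Note that [p s t i i] also counts paths that left [i] and came back; this is the
    origin of the term in [q (- i)]. *)
Lemma transition_forward_stay (s t i : R) : 0 <= s -> s < t -> is_well i ->
  is_derive t 1 (fun u => p s u i i)
    (q (- i) t * (1 - p s t i i) - q i t * p s t i i).
Proof.
move=> s0 st wi; apply: (is_derive_eq (transition_forward tp s0 st wi wi)).
have hs : p s t i (- i) = 1 - p s t i i.
  by rewrite -(transition_sum s0 (ltW st) wi) addrC addKr.
rewrite /generator.
have h1 : (1 == -1 :> R) = false by apply/negbTE/eqP => h; lra.
have h2 : (-1 == 1 :> R) = false by rewrite eq_sym.
by case: wi hs => ->; rewrite ?opprK !eqxx ?h1 ?h2 => ->; ring.
Qed.

(** The mean value theorem takes the place of integrating the forward equation. That equation holds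
    only for [t > s], so continuity at [s] comes from [transition_cvg]. *)
Lemma transition_stay_MVT (s t i : R) : 0 <= s -> s < t -> is_well i ->
  exists2 u, s < u < t & p s t i i =
    1 + (q (- i) u * (1 - p s u i i) - q i u * p s u i i) * (t - s).
Proof.
move=> s0 st wi.
have hder x : s < x -> is_derive x 1 (fun u => p s u i i)
    (q (- i) x * (1 - p s x i i) - q i x * p s x i i).
  by move=> sx; exact: transition_forward_stay.
have hcont x : s < x -> {for x, continuous (fun u => p s u i i)}.
  by move=> sx; apply: differentiable_continuous; apply/derivable1_diffP;
    case: (hder x sx).
have [||u] := @MVT R (fun u => p s u i i)
  (fun u => q (- i) u * (1 - p s u i i) - q i u * p s u i i) s t st.
- by move=> x; rewrite in_itv /= => /andP[sx _]; exact: hder.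
- apply/(continuous_within_itvP _ st); split.
  + by move=> x; rewrite in_itv /= => /andP[sx _]; exact: hcont.
  + exact: (transition_cvg tp s0 wi wi).
  + by apply: cvg_at_left_filter; exact: hcont.
rewrite in_itv /= => sut /eqP; rewrite subr_eq addrC => /eqP h.
by exists u => //; rewrite h (transition_id tp s0 wi wi) eqxx.
Qed.

Hypothesis q0 : forall i t, 0 <= q i t.

(** The return term [q (- i) u * (1 - p s u i i)] is nonnegative and is dropped. *)
Lemma transition_stay_ge (s t i Q : R) : 0 <= s -> s < t -> is_well i ->
  (forall u, s < u < t -> q i u <= Q) -> 1 - Q * (t - s) <= p s t i i.
Proof.
move=> s0 st wi hQ; have [u /[dup] sut /andP[su ut] ->] :=
  transition_stay_MVT s0 st wi.
have p1 := transition_stay_le1 s0 (ltW su) wi.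
have p0 := transition_ge0 tp s0 (ltW su) wi wi.
rewrite lerD2l -(mulNr Q) ler_pM2r ?subr_gt0 //.
have := hQ u sut; have := q0 i u; have := q0 (- i) u; nra.
Qed.

(** Since [1 - p s u i i] is at most [M * (t - s)], replacing [p s u i i] by [1] in the derivative
    costs at most [M ^+ 2 * (t - s)] in each of its two terms. *)
Lemma transition_stay_le (s t i c M : R) :
  0 <= s -> s < t -> is_well i -> 0 <= c ->
  (forall u, s < u < t -> [/\ c <= q i u, q i u <= M & q (- i) u <= M]) ->
  p s t i i <= 1 - (c - 2 * M ^+ 2 * (t - s)) * (t - s).
Proof.
move=> s0 st wi c0 h; have [u /[dup] sut /andP[su ut] ->] :=
  transition_stay_MVT s0 st wi.
have hge : 1 - M * (u - s) <= p s u i i.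
  apply: transition_stay_ge => // v /andP[sv vu].
  by have [] := h v; rewrite ?sv ?(lt_trans vu).
have p1 := transition_stay_le1 s0 (ltW su) wi.
have [h1 h2 h3] := h u sut; have h4 := q0 (- i) u.
rewrite lerD2l -(mulNr (c - _)) ler_pM2r ?subr_gt0 //.
have M0 : 0 <= M by lra.
set P := p s u i i in hge p1 *.
have hd : 1 - P <= M * (t - s) by nra.
have e1 : q (- i) u * (1 - P) <= M * (1 - P) by rewrite ler_wpM2r // subr_ge0.
have e2 : q i u * (1 - P) <= M * (1 - P) by rewrite ler_wpM2r // subr_ge0.
have e3 : M * (1 - P) <= M * (M * (t - s)) by rewrite ler_wpM2l.
rewrite expr2; lra.
Qed.

End TransitionBounds.

(** * Law of the hitting time *)

Lemma near_right_ex (R : realType) (t : R) (A : R -> Prop) :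
  (\forall u \near t^'+, A u) ->
  exists2 e, 0 < e & forall u, t < u < t + e -> A u.
Proof.
move=> [e /= e0 he]; exists e => // u /andP[tu ue]; apply: he => //=.
by rewrite /ball_ /= distrC gtr0_norm ?subr_gt0 // ltrBlDl.
Qed.

Section HittingTime.
Context {R : realType} {d : measure_display} {Omega : measurableType d}.
Variables (P : probability Omega R) (Y : R -> Omega -> R).
Variables (q : R -> R -> R) (p : R -> R -> R -> R -> R) (i : R).
Hypothesis tp : transition_function q p.
Hypothesis mp : markov_process P Y p i.
Hypothesis wi : is_well i.
Hypothesis q0 : forall j t, 0 <= q j t.

Let pr (A : set Omega) : R := fine (P A).

Lemma prE A : measurable A -> P A = (pr A)%:E.
Proof. by move=> mA; rewrite /pr fineK // fin_num_measure. Qed.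

Lemma pr_ge0 A : 0 <= pr A.
Proof. by rewrite fine_ge0. Qed.

Lemma pr_le A B : measurable A -> measurable B -> A `<=` B -> pr A <= pr B.
Proof.
by move=> mA mB AB; rewrite -lee_fin -!prE // le_measure // inE.
Qed.

Lemma pr_le1 A : measurable A -> pr A <= 1.
Proof. by move=> mA; rewrite -lee_fin -prE // probability_le1. Qed.

Lemma pr_setI_ge A B : measurable A -> measurable B ->
  pr A - pr (~` B) <= pr (A `&` B).
Proof.
move=> mA mB; rewrite lerBlDr -lee_fin EFinD -!prE //; last 2 first.
- exact: measurableC.
- exact: measurableI.
apply: (le_trans _ (measureU2 _ _ _)); last 2 first.
- exact: measurableI.
- exact: measurableC.
rewrite le_measure ?inE //.
- by apply: measurableU; [exact: measurableI | exact: measurableC].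
- by move=> w Aw; have [Bw|] := pselect (B w); [left | right].
Qed.

Lemma state_neq t w : 0 <= t -> Y t w <> i -> Y t w = - i.
Proof.
by move=> t0; have := process_state mp w t0; case: wi => -> [] ->;
  rewrite ?opprK.
Qed.

Lemma measurable_state t j : 0 <= t -> measurable [set w | Y t w = j].
Proof.
move=> t0; rewrite -[X in measurable X]setTI.
exact: (process_measurable mp t0) measurableT _ (measurable_set1 j).
Qed.

Lemma measurable_cylinder past : (forall c, c \in past -> 0 <= c.1) ->
  measurable (cylinder Y past).
Proof.
elim: past => [_|c past IH h].
  by rewrite (_ : cylinder _ _ = setT) //; apply/seteqP; split.
rewrite (_ : cylinder _ _ = [set w | Y c.1 w = c.2] `&` cylinder Y past).
  apply: measurableI.
    by apply: measurable_state; apply: h; rewrite mem_head.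
  by apply: IH => c' hc; apply: h; rewrite inE hc orbT.
apply/seteqP; split => w /=.
  by move=> hw; split=> [|c' hc]; apply: hw; rewrite inE ?eqxx ?hc ?orbT.
by move=> [h1 h2] c'; rewrite inE => /orP[/eqP -> // | /h2].
Qed.

(** There are [n] points, hence one step fewer; the estimates for [n] steps below therefore concern
    [n.+1] points. *)
Definition grid (s dlt : R) (n : nat) : seq (R * R) :=
  mkseq (fun k => (s + k%:R * dlt, i)) n.

Lemma cylinder_grid s dlt n : cylinder Y (grid s dlt n) =
  [set w | forall k, (k < n)%N -> Y (s + k%:R * dlt) w = i].
Proof.
apply/seteqP; split => w /= h.
  by move=> k kn; apply: (h (_, i)); apply: map_f; rewrite mem_iota.
by move=> c /mapP[k]; rewrite mem_iota => /= kn -> /=; exact: h.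
Qed.

Lemma measurable_grid s dlt n : 0 <= s -> 0 <= dlt ->
  measurable (cylinder Y (grid s dlt n)).
Proof.
move=> s0 d0; apply: measurable_cylinder => c /mapP[k _ ->] /=.
by rewrite addr_ge0 // mulr_ge0.
Qed.

Lemma pr_gridS s dlt n : 0 <= s -> 0 <= dlt ->
  pr (cylinder Y (grid s dlt n.+2)) =
  pr (cylinder Y (grid s dlt n.+1)) *
  p (s + n%:R * dlt) (s + n.+1%:R * dlt) i i.
Proof.
move=> s0 d0; apply: EFin_inj; rewrite EFinM -!prE; try exact: measurable_grid.
rewrite /grid !mkseqS (process_markov mp) //.
- by rewrite addr_ge0 // mulr_ge0.
- by rewrite lerD2l ler_wpM2r // ler_nat.
- move=> c /mapP[k]; rewrite mem_iota => /= kn -> /=.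
  by rewrite addr_ge0 ?mulr_ge0 //= lerD2l ler_wpM2r // ler_nat ltnW.
Qed.

(** The chain starts in [i] almost surely, and each step loses at most [Q * dlt] of probability. *)
Lemma pr_grid_ge dlt n Q : 0 < dlt ->
  (forall t, 0 <= t <= n%:R * dlt -> q i t <= Q) ->
  1 - Q * (n%:R * dlt) <= pr (cylinder Y (grid 0 dlt n.+1)).
Proof.
move=> d0; elim: n => [_|n IH hQ].
  rewrite mul0r mulr0 subr0 /pr.
  suff -> : P (cylinder Y (grid 0 dlt 1)) = 1%E by [].
  rewrite -[RHS](process_start mp); congr (P _); rewrite cylinder_grid.
  apply/seteqP; split=> w /=.
    by move=> /(_ 0%N isT); rewrite mul0r addr0.
  by move=> h [|//] _; rewrite mul0r addr0.
have n0 : 0 <= n%:R * dlt by rewrite mulr_ge0 // ltW.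
have nS : n.+1%:R * dlt = n%:R * dlt + dlt by rewrite -natr1 mulrDl mul1r.
rewrite nS in hQ *.
have {}IH : 1 - Q * (n%:R * dlt) <= pr (cylinder Y (grid 0 dlt n.+1)).
  by apply: IH => t /andP[t0 tn]; apply: hQ; rewrite t0; lra.
have Q0 : 0 <= Q by apply: le_trans (q0 i 0) (hQ _ _); lra.
rewrite (pr_gridS _ (lexx _) (ltW d0)) !add0r nS.
have : 1 - Q * (n%:R * dlt + dlt - n%:R * dlt) <=
    p (n%:R * dlt) (n%:R * dlt + dlt) i i.
  apply: (transition_stay_ge tp q0) => //; first lra.
  by move=> u hu; apply: hQ; lra.
have : pr (cylinder Y (grid 0 dlt n.+1)) <= 1.
  by apply: pr_le1; apply: measurable_grid => //; exact: ltW.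
have := pr_ge0 (cylinder Y (grid 0 dlt n.+1)).
rewrite (_ : n%:R * dlt + dlt - n%:R * dlt = dlt); last by ring.
set x := pr _ in IH *; set y := p _ _ _ _ => x0 x1 hy.
have : x * (1 - Q * dlt) <= x * y by rewrite ler_wpM2l.
have : x * (Q * dlt) <= 1 * (Q * dlt) by rewrite ler_wpM2r // mulr_ge0 // ltW.
lra.
Qed.

(** The bound on [dlt] keeps the second-order error below half of [c], so each step contributes a
    factor at most [1 - c / 2 * dlt], which is below [expR (- (c / 2 * dlt))]. *)
Lemma pr_grid_le s dlt n c M : 0 <= s -> 0 < dlt -> 0 <= c ->
  2 * M ^+ 2 * dlt <= c / 2 ->
  (forall t, s <= t <= s + n%:R * dlt ->
     [/\ c <= q i t, q i t <= M & q (- i) t <= M]) ->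
  pr (cylinder Y (grid s dlt n.+1)) <= expR (- (c / 2 * (n%:R * dlt))).
Proof.
move=> s0 d0 c0 hd; elim: n => [_|n IH hq].
  rewrite mul0r mulr0 oppr0 expR0 pr_le1 //.
  by apply: measurable_grid => //; exact: ltW.
have n0 : 0 <= n%:R * dlt by rewrite mulr_ge0 // ltW.
have nS : n.+1%:R * dlt = n%:R * dlt + dlt by rewrite -natr1 mulrDl mul1r.
rewrite nS in hq *.
have {}IH :
    pr (cylinder Y (grid s dlt n.+1)) <= expR (- (c / 2 * (n%:R * dlt))).
  by apply: IH => t /andP[st tn]; apply: hq; rewrite st; lra.
rewrite (pr_gridS _ s0 (ltW d0)) nS mulrDr opprD expRD.
apply: ler_pM => //; first exact: pr_ge0.
  by apply: (transition_ge0 tp) => //; lra.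
have := @transition_stay_le _ _ _ tp q0 (s + n%:R * dlt)
  (s + (n%:R * dlt + dlt)) i c M.
rewrite (_ : s + (n%:R * dlt + dlt) - (s + n%:R * dlt) = dlt); last by ring.
move=> h; apply: (le_trans (h _ _ _ _ _)) => //; try lra.
  by move=> u hu; apply: hq; lra.
apply: le_trans (expR_ge1Dx _); rewrite lerD2l lerN2 ler_wpM2r //; lra.
Qed.

(* The step of the grid only has to be small compared with c / M^2; refining it
   further would remove the factor 1 / 2 from the exponent. *)
Lemma pr_stay_le F s1 s2 c M : measurable F -> 0 <= s1 -> s1 < s2 -> 0 <= c ->
  (forall t, s1 <= t <= s2 -> [/\ c <= q i t, q i t <= M & q (- i) t <= M]) ->
  (forall w, F w -> forall t, s1 <= t <= s2 -> Y t w = i) ->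
  pr F <= expR (- (c / 2 * (s2 - s1))).
Proof.
move=> mF s10 s12 c0 hq hF.
have [c00|cpos] := leP c 0.
  have -> : c = 0 by lra.
  by rewrite !mul0r oppr0 expR0 pr_le1.
set L := s2 - s1; have L0 : 0 < L by rewrite subr_gt0.
have A0 : 0 <= 4 * M ^+ 2 * L / c.
  apply: divr_ge0; last exact: ltW.
  by rewrite mulr_ge0 ?(ltW L0) // mulr_ge0 // sqr_ge0.
have := archi_boundP A0; set n := Num.bound _ => hn.
have n0 : 0 < n%:R :> R by exact: le_lt_trans A0 hn.
have nL : n%:R * (L / n%:R) = L by rewrite mulrCA divff ?gt_eqF // mulr1.
have d0 : 0 < L / n%:R by rewrite divr_gt0.
rewrite -nL; apply: (le_trans (y := pr (cylinder Y (grid s1 (L / n%:R) n.+1)))).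
  apply: pr_le => //; first by apply: measurable_grid => //; exact: ltW.
  rewrite cylinder_grid => w Fw k kn /=; apply: hF => //.
  have : k%:R * (L / n%:R) <= n%:R * (L / n%:R).
    by apply: ler_wpM2r; [exact: ltW | rewrite ler_nat].
  have : 0 <= k%:R * (L / n%:R) by rewrite mulr_ge0 // ltW.
  rewrite nL /L; lra.
apply: (@pr_grid_le _ _ _ _ M) => //.
  apply: ltW; rewrite mulrA ltr_pdivrMr //.
  by move: hn; rewrite ltr_pdivrMr //; lra.
by move=> t; rewrite nL /L => ht; apply: hq; lra.
Qed.

Lemma hitting_time_ge t w : 0 <= t ->
  (t%:E <= hitting_time Y (- i) w)%E <-> forall u, 0 <= u < t -> Y u w = i.
Proof.
move=> t0; split=> [h u /andP[u0 ut]|h].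
  apply: contrapT => /(state_neq u0) Yu; move: ut; apply/negP; rewrite -leNgt.
  by rewrite -lee_fin (le_trans h) //; apply: ereal_inf_lbound; exists u.
apply: le_ereal_inf_tmp => _ [u [u0 Yu] <-]; rewrite lee_fin leNgt.
apply/negP => ut; have := h u; rewrite u0 ut => /(_ isT); rewrite Yu => /eqP.
by rewrite well_oppE.
Qed.

(** By right continuity a path that is in [i] at time [t] stays there a little longer, which makes
    the inequality strict. *)
Lemma hitting_time_gt t w : 0 <= t ->
  (t%:E < hitting_time Y (- i) w)%E <-> forall u, 0 <= u <= t -> Y u w = i.
Proof.
move=> t0; split=> [h u /andP[u0 ut]|h].
  apply: contrapT => /(state_neq u0) Yu; have : (t%:E < u%:E)%E.
    by apply: (lt_le_trans h); apply: ereal_inf_lbound; exists u.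
  by rewrite lte_fin ltNge ut.
have /near_right_ex[e e0 he] : \forall u \near t^'+, Y u w = i.
  have := process_right_continuous mp w t0.
  by apply: filterS => u ->; apply: h; rewrite t0 lexx.
have te : t < t + e by rewrite ltrDl.
apply: (@lt_le_trans _ _ (t + e)%:E); first by rewrite lte_fin.
apply/hitting_time_ge; first lra.
move=> u /andP[u0 ut]; have [ut'|tu] := leP u t; first by apply: h; rewrite u0.
by apply: he; rewrite tu.
Qed.

(** By right continuity a visit to [- i] before [t] lasts for some time and is seen by every
    sufficiently fine dyadic grid. This gives measurability, and an approximation by a decreasing
    sequence of cylinders. *)
Lemma hitting_time_geE t : 0 < t ->
  [set w | (t%:E <= hitting_time Y (- i) w)%E] =
  \bigcap_n cylinder Y (grid 0 (t / (2 ^ n)%:R) (2 ^ n)).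
Proof.
move=> t0; apply/seteqP; split => w /=.
  move=> /(hitting_time_ge _ (ltW t0)) h n _; rewrite cylinder_grid => k kn /=.
  have n0 : 0 < (2 ^ n)%:R :> R by rewrite ltr0n expn_gt0.
  apply: h; rewrite add0r mulr_ge0 ?(divr_ge0 (ltW t0)) //=.
  by rewrite mulrCA gtr_pMr // ltr_pdivrMr // mul1r ltr_nat.
move=> h; apply/(hitting_time_ge _ (ltW t0)) => u /andP[u0 ut].
apply: contrapT => /(state_neq u0) Yu.
have /near_right_ex[e e0 he] := process_right_continuous mp w u0.
set m := Num.min e (t - u).
have m0 : 0 < m by rewrite lt_min e0 subr_gt0.
have me : m <= e by rewrite ge_min lexx.
have mt : m <= t - u by rewrite ge_min lexx orbT.
have A0 : 0 <= t / m by rewrite divr_ge0 ?ltW.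
have := archi_boundP A0; set n := Num.bound _ => hn.
have n0 : 0 < (2 ^ n)%:R :> R by rewrite ltr0n expn_gt0.
set dlt := t / (2 ^ n)%:R; have d0 : 0 < dlt by rewrite divr_gt0.
have dm : dlt < m.
  rewrite /dlt ltr_pdivrMr // mulrC -ltr_pdivrMr // (lt_trans hn) //.
  by rewrite ltr_nat ltn_expl.
have ud0 : 0 <= u / dlt by rewrite divr_ge0 // ltW.
(* The point [k.+1%:R * dlt] is the first grid point after [u]; as [dlt < m], it lies before [t] and
   inside the visit to [- i]. *)
have /andP[] := truncn_itv ud0; set k := Num.trunc _.
rewrite ler_pdivlMr // ltr_pdivrMr // => ku uk.
have kS : k.+1%:R * dlt = k%:R * dlt + dlt by rewrite -natr1 mulrDl mul1r.
have kn : (k.+1 < 2 ^ n)%N.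
  rewrite -(ltr_nat R) -(ltr_pM2r d0).
  have nt : (2 ^ n)%:R * dlt = t by rewrite /dlt mulrCA divff ?gt_eqF ?mulr1.
  rewrite nt kS; lra.
have := h n I; rewrite cylinder_grid => /(_ _ kn); rewrite add0r -/dlt.
rewrite he ?Yu; last by rewrite uk kS; lra.
by move/eqP; rewrite well_oppE.
Qed.

Lemma measurable_hitting_time_ge t : 0 < t ->
  measurable [set w | (t%:E <= hitting_time Y (- i) w)%E].
Proof.
move=> t0; rewrite hitting_time_geE //; apply: bigcapT_measurable => n.
by apply: measurable_grid => //; rewrite divr_ge0 ?ltW.
Qed.

Lemma measurable_hitting_time_gt t : 0 < t ->
  measurable [set w | (t%:E < hitting_time Y (- i) w)%E].
Proof.
move=> t0; rewrite (_ : [set w | _] =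
    [set w | (t%:E <= hitting_time Y (- i) w)%E] `&` [set w | Y t w = i]).
  apply: measurableI; first exact: measurable_hitting_time_ge.
  exact/measurable_state/ltW.
apply/seteqP; split=> w /=.
  move=> /[dup] /ltW h1 /(hitting_time_gt _ (ltW t0)) h2; split=> //.
  by apply: h2; rewrite lexx ltW.
move=> [/(hitting_time_ge _ (ltW t0)) h1 h2]; apply/(hitting_time_gt _ (ltW t0)).
move=> u /andP[u0]; rewrite le_eqVlt => /orP[/eqP -> // | ut].
by apply: h1; rewrite u0.
Qed.

Lemma measurable_hitting_time_le t : 0 < t ->
  measurable [set w | (hitting_time Y (- i) w <= t%:E)%E].
Proof.
move=> t0; rewrite (_ : [set w | _] =
    ~` [set w | (t%:E < hitting_time Y (- i) w)%E]).
  exact/measurableC/measurable_hitting_time_gt.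
by apply/seteqP; split=> w /=; rewrite leNgt => /negP.
Qed.

(** Continuity from above along the dyadic grids, whose probabilities all obey the bound. *)
Lemma pr_hitting_time_ge t Q : 0 < t -> (forall u, 0 <= u <= t -> q i u <= Q) ->
  1 - Q * t <= pr [set w | (t%:E <= hitting_time Y (- i) w)%E].
Proof.
move=> t0 hQ; rewrite -lee_fin -prE; last exact: measurable_hitting_time_ge.
have Q0 : 0 <= Q by apply: le_trans (q0 i 0) (hQ _ _); rewrite lexx ltW.
have n0 n : 0 < (2 ^ n)%:R :> R by rewrite ltr0n expn_gt0.
have d0 n : 0 < t / (2 ^ n)%:R by rewrite divr_gt0.
have mG n : measurable (cylinder Y (grid 0 (t / (2 ^ n)%:R) (2 ^ n))).
  by apply: measurable_grid => //; exact: ltW.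
rewrite hitting_time_geE //.
have hcvg := @nonincreasing_cvg_mu _ _ _ P
  (fun n => cylinder Y (grid 0 (t / (2 ^ n)%:R) (2 ^ n))).
apply: (cvge_ge _ (hcvg _ mG _ _)).
- apply: nearW => n /=; rewrite prE // lee_fin.
  have [k kE] : exists k, (2 ^ n)%N = k.+1.
    by exists (2 ^ n).-1; rewrite prednK // expn_gt0.
  have kt : k%:R * (t / (2 ^ n)%:R) <= t.
    by rewrite mulrCA ger_pMr // ler_pdivrMr // mul1r ler_nat kE.
  rewrite {2}kE; apply: (le_trans (y := 1 - Q * (k%:R * (t / (2 ^ n)%:R)))).
    by rewrite lerD2l lerN2 ler_wpM2l.
  by apply: pr_grid_ge => // u hu; apply: hQ; lra.
- by rewrite (le_lt_trans (probability_le1 _ _)) ?ltry.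
- exact: bigcapT_measurable.
- apply/nonincreasing_seqP => n; apply/subsetPset; rewrite !cylinder_grid.
  move=> w /= h k kn.
  (* Point [k] of a dyadic grid is point [2 * k] of the next one. *)
  have := h (2 * k)%N; rewrite expnS ltn_pmul2l // => /(_ kn).
  rewrite !natrM invfM (_ : 2 * k%:R * _ = k%:R * (t / (2 ^ n)%:R)) //.
  by field; rewrite gt_eqF.
Qed.

Let window t1 t2 := [set w | (t1%:E <= hitting_time Y (- i) w)%E /\
  (hitting_time Y (- i) w <= t2%:E)%E].

(** The window is missed either by jumping before [t1], which costs [Q * t1], or by jumping after
    [t2], which requires staying in [i] throughout [[s1, s2]]. *)
Lemma window_error_le t1 t2 s1 s2 Q c M : 0 < t1 -> 0 < t2 ->
  0 <= s1 -> s1 < s2 -> s2 <= t2 -> 0 <= c ->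
  (forall u, 0 <= u <= t1 -> q i u <= Q) ->
  (forall t, s1 <= t <= s2 -> [/\ c <= q i t, q i t <= M & q (- i) t <= M]) ->
  1 - pr (window t1 t2) <= Q * t1 + expR (- (c / 2 * (s2 - s1))).
Proof.
move=> t10 t20 s10 s12 s2t c0 hQ hq.
have := pr_hitting_time_ge t10 hQ.
have : _ <= pr (window t1 t2) := pr_setI_ge (measurable_hitting_time_ge t10)
  (measurable_hitting_time_le t20).
suff : pr (~` [set w | (hitting_time Y (- i) w <= t2%:E)%E]) <=
    expR (- (c / 2 * (s2 - s1))) by lra.
apply: (@pr_stay_le _ _ _ _ M) => //.
  exact/measurableC/measurable_hitting_time_le.
move=> w /= /negP; rewrite -ltNge => /(hitting_time_gt _ (ltW t20)) h t ht.
by apply: h; lra.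
Qed.

(** Hitting inside the window requires staying in [i] throughout [[s1, s2]], which precedes the
    window. *)
Lemma window_error_ge t1 t2 s1 s2 c M : 0 < t1 -> 0 < t2 ->
  0 <= s1 -> s1 < s2 -> s2 < t1 -> 0 <= c ->
  (forall t, s1 <= t <= s2 -> [/\ c <= q i t, q i t <= M & q (- i) t <= M]) ->
  1 - expR (- (c / 2 * (s2 - s1))) <= 1 - pr (window t1 t2).
Proof.
move=> t10 t20 s10 s12 s2t c0 hq; rewrite lerD2l lerN2.
apply: (@pr_stay_le _ _ _ _ M) => //.
  by apply: measurableI;
    [exact: measurable_hitting_time_ge | exact: measurable_hitting_time_le].
move=> w [/(hitting_time_ge _ (ltW t10)) h _] t ht.
by apply: h; lra.
Qed.

End HittingTime.

(** * First entrance of the depth below a level *)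

Lemma itv0yP (R : realType) (t : R) : (`[0, +oo[ : set R) t <-> 0 <= t.
Proof. by rewrite /= in_itv /= andbT. Qed.

(** * Continuity of the depth functions in time *)

Section DepthContinuity.
Variables (R : realType) (U : R -> R -> R).
Hypothesis hU : double_well_potential U.

(** Compactness of [[-1, 1]] makes the joint continuity of the derivative uniform in [x]. *)
Lemma derive1_near_uniform (t0 e : R) : 0 <= t0 -> 0 < e ->
  \forall t \near within [set t | 0 <= t] (nbhs t0),
    `[-1, 1] `<=` [set x | `|derive1 (U t) x - derive1 (U t0) x| < e].
Proof.
move=> t00 e0.
have /compact_near_coveringP hc := @segment_compact R (-1) 1.
apply: (hc R _ (fun t x => `|derive1 (U t) x - derive1 (U t0) x| < e)) => x _.
have /subspace_continuousP/(_ (t0, x) t00)/cvgrPdist_lt := potential_C1 hU.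
move=> /(_ (e / 2)); rewrite divr_gt0 // => /(_ isT) [[B C] /= [hB hC] h].
exists (C, [set t | 0 <= t /\ B t]); first split=> //=.
  by apply: filterS hB => t Bt; split.
move=> [x' t] /= [Cx' [t'0 Bt]].
have /= h1 := h (t, x') (conj Bt Cx') t'0.
have /= h2 := h (t0, x') (conj (nbhs_singleton hB) Cx') t00.
rewrite distrC in h1.
by rewrite (le_lt_trans (ler_distD (derive1 (U t0) x) _ _)) // (splitr e) ltrD.
Qed.

(** Continuity in time is assumed for the derivative of [U] in [x], not for [U]. Since the depth is
    an increment of [U] in [x], the mean value theorem for [U t - U s] between [0] and [i] transfers
    it. *)
Lemma depth_diff_MVT (i s t : R) : is_well i -> 0 <= s -> 0 <= t ->
  exists2 x, -1 <= x <= 1 &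
    `|depth U i t - depth U i s| = `|derive1 (U t) x - derive1 (U s) x|.
Proof.
move=> wi s0 t0; pose g (x : R) : R := U t x - U s x.
have dg (x : R) : is_derive x (1 : R) g (derive1 (U t) x - derive1 (U s) x).
  by rewrite !derive1E; apply: is_deriveB; apply/derivableP;
    apply: (potential_derivable hU).
have cg : continuous g.
  by move=> x; apply: differentiable_continuous; apply/derivable1_diffP;
    case: (dg x).
have hMVT (a b : R) : a < b -> exists2 c, a < c < b &
    g b - g a = (derive1 (U t) c - derive1 (U s) c) * (b - a).
  move=> ab.
  have [|c] := @MVT R g (fun x => derive1 (U t) x - derive1 (U s) x) a b ab.
    exact: continuous_subspaceT.
  by rewrite in_itv /=; exists c.
have dE : depth U i t - depth U i s = g 0 - g i by rewrite /depth /g; ring.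
rewrite dE; case: wi => ->.
- have [c hc] := hMVT 0 1 ltr01; rewrite subr0 mulr1 => h.
  by exists c; [lra | rewrite distrC h].
- have [c hc] := hMVT (-1) 0 (ltrN10 R); rewrite sub0r opprK mulr1 => h.
  by exists c; [lra | rewrite h].
Qed.

Lemma depth_continuous (i : R) : is_well i ->
  {within `[0, +oo[, continuous (depth U i)}.
Proof.
move=> wi; apply/subspace_continuousP => t0 /itv0yP t00.
apply/cvgrPdist_lt => e e0.
have := derive1_near_uniform t00 e0; rewrite !near_withinE.
apply: filterS => t h /itv0yP t'0.
have [x hx] := depth_diff_MVT wi t00 t'0.
by rewrite distrC => ->; apply: (h t'0); rewrite /= in_itv.
Qed.

End DepthContinuity.

Section FirstEntrance.
Variables (R : realType) (D : R -> R).
Hypothesis cD : {within `[0, +oo[, continuous D}.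

Lemma continuous_near_lt t y : 0 <= t -> D t < y ->
  exists2 e, 0 < e & forall s, 0 <= s -> `|s - t| < e -> D s < y.
Proof.
move=> /itv0yP t0 ty; have /subspace_continuousP/(_ t t0)/cvgrPdist_lt := cD.
move=> /(_ (y - D t)); rewrite subr_gt0 => /(_ ty) [e /= e0 h].
exists e => // s s0 st; rewrite distrC in st.
have h1 : `|D t - D s| < y - D t := h s st (iffRL (itv0yP s) s0).
by move: h1; rewrite ltr_norml; lra.
Qed.

Lemma continuous_near_gt t y : 0 <= t -> y < D t ->
  exists2 e, 0 < e & forall s, 0 <= s -> `|s - t| < e -> y < D s.
Proof.
move=> /itv0yP t0 ty; have /subspace_continuousP/(_ t t0)/cvgrPdist_lt := cD.
move=> /(_ (D t - y)); rewrite subr_gt0 => /(_ ty) [e /= e0 h].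
exists e => // s s0 st; rewrite distrC in st.
have h1 : `|D t - D s| < D t - y := h s st (iffRL (itv0yP s) s0).
by move: h1; rewrite ltr_norml; lra.
Qed.

Lemma continuous_min s t : 0 <= s -> s <= t ->
  exists2 m, s <= m <= t & forall u, s <= u <= t -> D m <= D u.
Proof.
move=> s0 st; have [|m] := @EVT_min R D s t st.
  by apply: continuous_subspaceW cD => u; rewrite /= !in_itv /= andbT; lra.
by rewrite in_itv /= => hm h; exists m => // u hu; apply: h; rewrite in_itv.
Qed.

(** For [D := depth U i] this is convertible to [entrance_time U mu i]. *)
Definition first_entrance (mu : R) : R := inf [set t | 0 <= t /\ D t <= mu].

Section Level.
Variable mu : R.
Hypotheses (D0 : mu < D 0) (Dmu : exists2 t : R, 0 <= t & D t <= mu).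
Let a := first_entrance mu.

Lemma gt_first_entrance s : 0 <= s -> s < a -> mu < D s.
Proof.
move=> s0; apply: contraTT; rewrite -!leNgt => Ds.
by apply: ge_inf; [exists 0 => t [] | split].
Qed.

Lemma first_entrance_ge x : (forall t, 0 <= t -> t < x -> mu < D t) -> x <= a.
Proof.
move=> h; have [t t0 Dt] := Dmu; apply: lb_le_inf; first by exists t.
move=> s [s0]; apply: contraTT; rewrite -!ltNge; exact: h.
Qed.

Lemma first_entrance_gt0 : 0 < a.
Proof.
have [e e0 h] := continuous_near_gt (lexx 0) D0.
apply: (lt_le_trans e0); apply: first_entrance_ge => t t0 te.
by apply: h => //; rewrite subr0 ger0_norm.
Qed.

Lemma first_entrance_le : D a <= mu.
Proof.
rewrite leNgt; apply/negP => h.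
have [e e0 he] := continuous_near_gt (ltW first_entrance_gt0) h.
suff : a + e <= a by lra.
apply: first_entrance_ge => t t0 te; have [ta|at_] := ltP t a.
  exact: gt_first_entrance.
by apply: he => //; rewrite ger0_norm; lra.
Qed.

Hypothesis D_min_global : forall t : R, 0 < t -> local_min D t ->
  forall s : R, 0 <= s -> D t <= D s.
Hypothesis D_below : exists2 t : R, 0 <= t & D t < mu.

(** If [D] only touched the level at [a], then [a] would be a local, hence global, minimum, and
    [D_below] would give [D a < mu]. By continuity [D] would then be below [mu] already before
    [a]. *)
Lemma first_entrance_crossing h : 0 < h -> exists2 s, a < s < a + h & D s < mu.
Proof.
move=> h0; apply: contrapT => hN; have a0 := first_entrance_gt0.
have lt_mu : D a < mu.
  have [t t0 Dt] := D_below; apply: (le_lt_trans _ Dt).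
  apply: D_min_global => //.
  have m0 : 0 < Num.min a h by rewrite lt_min a0.
  exists (Num.min a h) => //= y; rewrite /ball_ /= => ya.
  have y1 : `|a - y| < a by apply: lt_le_trans ya _; rewrite ge_min lexx.
  have y2 : `|a - y| < h by apply: lt_le_trans ya _; rewrite ge_min lexx orbT.
  have Da := first_entrance_le.
  move: y1 y2; rewrite !ltr_norml => y1 y2.
  case: (ltgtP y a) => [lt|gt|-> //].
    by apply: (le_trans Da); apply/ltW/gt_first_entrance => //; lra.
  apply: (le_trans Da); rewrite leNgt; apply/negP => Dy.
  by apply: hN; exists y => //; lra.
have [e e0 he] := continuous_near_lt (ltW a0) lt_mu.
set m := Num.min a (e / 2).
have m0 : 0 < m by rewrite lt_min a0 divr_gt0.
have m1 : m <= a by rewrite ge_min lexx.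
have m2 : m <= e / 2 by rewrite ge_min lexx orbT.
have : D (a - m) < mu.
  apply: he; rewrite ?subr_ge0 //.
  by rewrite addrAC subrr sub0r normrN gtr0_norm //; lra.
have : mu < D (a - m) by apply: gt_first_entrance; lra.
lra.
Qed.

(** The gap [kappa] makes the jump rate, in units of [1 / T], at least [expR (kappa / eps)] on a
    whole interval before [a + h]; jumping later than that is doubly exponentially unlikely. *)
Lemma first_entrance_dip h : 0 < h ->
  exists b1 b2 kappa, [/\ a < b1, b1 < b2, b2 < a + h, 0 < kappa &
    forall t, b1 <= t <= b2 -> D t <= mu - kappa].
Proof.
move=> /first_entrance_crossing[s hs Ds]; have a0 := first_entrance_gt0.
have Ds' : D s < mu - (mu - D s) / 2 by lra.
have s0 : 0 <= s by lra.
have [e e0 he] := continuous_near_lt s0 Ds'.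
set m := Num.min (e / 2) ((a + h - s) / 2).
have m0 : 0 < m by rewrite lt_min !divr_gt0 //; lra.
have m1 : m <= e / 2 by rewrite ge_min lexx.
have m2 : m <= (a + h - s) / 2 by rewrite ge_min lexx orbT.
exists s, (s + m), ((mu - D s) / 2); split; try lra.
by move=> t ht; apply/ltW/he; [lra | rewrite ger0_norm; lra].
Qed.

(* A minimum of D over [0, s] in the open interval would be a local, hence
   global, minimum with a value above mu. *)
Lemma first_entrance_min s : 0 < s -> s < a ->
  (exists2 u : R, 0 <= u <= s & D u < D 0) ->
  forall u, 0 <= u <= s -> D s <= D u.
Proof.
move=> s0 sa [v hv Dv] u hu; have [m hm h] := continuous_min (lexx 0) (ltW s0).
suff -> : s = m by exact: h.
apply/eqP; rewrite eq_le; apply/andP; split; last by lra.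
(* The hypothesis on local minima says nothing about time [0]; a minimum there is excluded by
   [D v < D 0]. *)
rewrite leNgt; apply/negP => ms; have [m0|m0] := ltP 0 m; last first.
  have mE : m = 0 by lra.
  by have := h v hv; rewrite mE; lra.
have [t t0 Dt] := D_below.
have : mu < D m by apply: gt_first_entrance; lra.
suff : D m <= D t by lra.
apply: D_min_global => //.
exists (Num.min m (s - m)); first by rewrite /= lt_min m0 subr_gt0.
move=> y; rewrite /= lt_min !ltr_norml => /andP[y1 y2]; apply: h; lra.
Qed.

End Level.

(** The entrance time [aM] of the highest level [M] is a lower bound for all entrance times, so one
    [h0] serves every [mu < M]. The value below [D 0] required by [first_entrance_min] is found at
    [aM], or at a point close to it when [first_entrance mu - h] falls short of [aM]. *)
Lemma first_entrance_uniform M :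
  M < D 0 -> (exists2 t : R, 0 <= t & D t <= M) ->
  (forall t : R, 0 < t -> local_min D t ->
    forall s : R, 0 <= s -> D t <= D s) ->
  exists2 h0, 0 < h0 & forall h mu, 0 < h -> h < h0 -> mu < M ->
    (exists2 t : R, 0 <= t & D t < mu) ->
    h < first_entrance mu /\
    forall u, 0 <= u <= first_entrance mu - h ->
      D (first_entrance mu - h) <= D u.
Proof.
move=> D0 DM Dmin; set aM := first_entrance M.
have aM0 : 0 < aM by exact: first_entrance_gt0.
have DaM : D aM < D 0 by apply: (le_lt_trans _ D0); exact: first_entrance_le.
have [e e0 he] := continuous_near_lt (ltW aM0) DaM.
have m0 : 0 < Num.min aM e by rewrite lt_min aM0.
exists (Num.min aM e) => // h mu h0; rewrite lt_min => /andP[haM hhe] muM Dmu.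
have D0mu : mu < D 0 by exact: lt_trans muM D0.
have Dmu' : exists2 t : R, 0 <= t & D t <= mu.
  by have [t t0 /ltW Dt] := Dmu; exists t.
have aa : aM <= first_entrance mu.
  apply: first_entrance_ge => // t t0 taM.
  by apply: (lt_trans muM); exact: gt_first_entrance.
split; first lra.
apply: (first_entrance_min (mu := mu)) => //; try lra.
have [saM|aMs] := leP (first_entrance mu - h) aM.
  exists (first_entrance mu - h); first lra.
  by apply: he; [lra | rewrite ltr_norml; lra].
by exists aM => //; lra.
Qed.

End FirstEntrance.

(** * Exponential rates *)

Section ExponentialRates.
Variable R : realType.

Lemma near0_lt (e : R) : 0 < e -> \forall eps \near 0^'+, 0 < eps < e.
Proof.
move=> e0; near=> eps; apply/andP; split; near: eps.
  exact: nbhs_right_gt.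
exact: nbhs_right_lt.
Unshelve. all: by end_near. Qed.

Lemma near0_linear_le_expR (A eta : R) : 0 < eta ->
  \forall eps \near 0^'+, A <= expR (eta / eps).
Proof.
move=> eta0; have A0 : 0 < `|A| + 1 by rewrite ltr_wpDl.
have : 0 < eta / (`|A| + 1) by rewrite divr_gt0.
move=> /near0_lt; apply: filterS => eps /andP[eps0].
rewrite ltr_pdivlMr // => h; apply: le_trans (expR_ge1Dx _).
have : `|A| + 1 <= eta / eps by rewrite ler_pdivlMr // mulrC ltW.
have := ler_norm A; lra.
Qed.

(** It is enough that [expR (kappa / eps)] dominates the square of [kappa / 2 / eps], as a term of
    order [eps ^- 2] beats [r / eps]. *)
Lemma near0_double_expR_le (B kappa r : R) : 0 < B -> 0 < kappa ->
  \forall eps \near 0^'+, expR (- (B * expR (kappa / eps))) <= expR (r / eps).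
Proof.
move=> B0 k0; have r0 : 0 < `|r| + 1 by rewrite ltr_wpDl.
have : 0 < B * (kappa / 2) ^+ 2 / (`|r| + 1).
  by rewrite divr_gt0 // mulr_gt0 // exprn_gt0 ?divr_gt0.
move=> /near0_lt; apply: filterS => eps /andP[eps0].
rewrite ltr_pdivlMr // => h; rewrite ler_expR.
have sq : (kappa / 2 / eps) ^+ 2 <= expR (kappa / eps).
  rewrite (_ : kappa / eps = kappa / 2 / eps + kappa / 2 / eps); last first.
    by field; rewrite gt_eqF.
  rewrite expRD expr2; set x := kappa / 2 / eps.
  have x0 : 0 <= x by rewrite /x !divr_ge0 // ltW.
  have := expR_ge1Dx x; nra.
have : B * (kappa / 2 / eps) ^+ 2 <= B * expR (kappa / eps).
  by rewrite ler_wpM2l // ltW.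
suff : - (r / eps) <= B * (kappa / 2 / eps) ^+ 2 by lra.
have -> : B * (kappa / 2 / eps) ^+ 2 = B * (kappa / 2) ^+ 2 / eps / eps.
  by field; rewrite gt_eqF.
rewrite -mulNr ler_pM2r ?invr_gt0 // ler_pdivlMr //.
have := ler_norm (- r); rewrite normrN => hr.
have : - r * eps <= `|r| * eps by rewrite ler_wpM2r // ltW.
lra.
Qed.

(** The factor [expR (eta / eps)] absorbs the prefactor [A] and the doubly exponential term. *)
Lemma near0_upper_rate (A B kappa r eta : R) :
  0 < B -> 0 < kappa -> 0 < eta ->
  \forall eps \near 0^'+,
    A * expR (r / eps) + expR (- (B * expR (kappa / eps))) <=
    expR ((r + eta) / eps).
Proof.
move=> B0 k0 eta0; near=> eps; rewrite mulrDl expRD.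
have h1 : A + 1 <= expR (eta / eps).
  by near: eps; exact: near0_linear_le_expR.
have h2 : expR (- (B * expR (kappa / eps))) <= expR (r / eps).
  by near: eps; exact: near0_double_expR_le.
have : expR (r / eps) * (A + 1) <= expR (r / eps) * expR (eta / eps).
  by rewrite ler_wpM2l ?expR_ge0.
lra.
Unshelve. all: by end_near. Qed.

(** For [0 < z <= 1], [1 - expR (- (B * z))] is at least [B * z / (1 + B)], and the constant
    [B / (1 + B)] is absorbed by [expR (eta / eps)]. *)
Lemma near0_lower_rate (B r eta : R) : 0 < B -> 0 < eta -> r + eta <= 0 ->
  \forall eps \near 0^'+,
    expR (r / eps) <= 1 - expR (- (B * expR ((r + eta) / eps))).
Proof.
move=> B0 eta0 r0; near=> eps.
have eps0 : 0 < eps by near: eps; exact: nbhs_right_gt.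
have h1 : (1 + B) / B <= expR (eta / eps).
  by near: eps; exact: near0_linear_le_expR.
set z := expR ((r + eta) / eps).
have z0 : 0 < z by exact: expR_gt0.
have z1 : z <= 1 by rewrite -expR0 ler_expR pmulr_lle0 ?invr_gt0.
have zE : z = expR (r / eps) * expR (eta / eps) by rewrite -expRD -mulrDl.
have zB : expR (r / eps) * (1 + B) <= z * B.
  rewrite zE -mulrA ler_pM2l ?expR_gt0 //.
  by move: h1; rewrite ler_pdivrMr.
set y := expR (r / eps) in zE zB *.
have y0 : 0 < y by exact: expR_gt0.
have E0 : 0 < 1 + B * z by rewrite addr_gt0 // mulr_gt0.
have h2 : expR (- (B * z)) <= (1 + B * z)^-1.
  by rewrite expRN lef_pV2 ?posrE ?expR_gt0 // expR_ge1Dx.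
suff : (1 + B * z)^-1 <= 1 - y by lra.
rewrite -[_^-1]mul1r ler_pdivrMr //.
have : y * (B * z) <= y * B by rewrite ler_pM2l // ger_pMr.
lra.
Unshelve. all: by end_near. Qed.

Lemma cvg_log_rate (E : R -> R) (r : R) :
  (forall eta, 0 < eta -> \forall eps \near 0^'+,
     expR ((r - eta) / eps) <= E eps <= expR ((r + eta) / eps)) ->
  eps * ln (E eps) @[eps --> 0^'+] --> r.
Proof.
move=> hE; apply/cvgrPdist_le => eta eta0; near=> eps.
have eps0 : 0 < eps by near: eps; exact: nbhs_right_gt.
have /andP[h1 h2] : expR ((r - eta) / eps) <= E eps <= expR ((r + eta) / eps).
  by near: eps; exact: hE.
(* Positivity keeps [ln] away from its default value. *)
have E0 : 0 < E eps by apply: lt_le_trans h1; exact: expR_gt0.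
have {}h1 : (r - eta) / eps <= ln (E eps).
  by rewrite -[leLHS]expRK ler_ln ?posrE ?expR_gt0.
have {}h2 : ln (E eps) <= (r + eta) / eps.
  by rewrite -[leRHS]expRK ler_ln ?posrE ?expR_gt0.
move: h1 h2; rewrite ler_pdivrMr // ler_pdivlMr // mulrC => h1 h2.
by rewrite ler_norml; lra.
Unshelve. all: by end_near. Qed.

End ExponentialRates.

(** * Windows around the entrance times, for levels in the resonance interval *)

Section Resonance.
Variables (R : realType) (U : R -> R -> R).
Hypotheses (hU : double_well_potential U) (hD : depth_assumptions U).

Lemma inf_time_lt (f : R -> R) (mu : R) : inf_time f < mu ->
  exists2 t : R, 0 <= t & f t < mu.
Proof.
move=> h; apply: contrapT => hN; move: h; apply/negP; rewrite -leNgt.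
apply: lb_le_inf; first by exists (f 0), 0 => //=.
move=> _ [t t0 <-]; rewrite leNgt; apply/negP => ft.
by apply: hN; exists t.
Qed.

Lemma resonance_interval_depth (mu i : R) : is_well i ->
  resonance_interval U mu ->
  [/\ mu < inf_max_depth U, inf_max_depth U < depth U i 0 &
      exists2 t : R, 0 <= t & depth U i t < mu].
Proof.
move=> wi; rewrite /resonance_interval /= in_itv /= gt_max.
move=> /andP[/andP[h1 h2] h3]; split=> //; first exact: depth_start.
by case: wi => ->; exact: inf_time_lt.
Qed.

Lemma depth_local_min_global (i : R) : is_well i ->
  forall t : R, 0 < t -> local_min (depth U i) t ->
  forall s : R, 0 <= s -> depth U i t <= depth U i s.
Proof. by move=> wi t t0; have [_] := depth_extrema hD wi t0. Qed.

(** Before the window the jump rate is largest at its left end [a - h], where it is still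
    exponentially small in units of [1 / T]; inside the window it is exponentially large on some
    interval. *)
Definition tame_window (i h mu : R) : Prop :=
  let a := entrance_time U mu i in
  [/\ h < a, mu < depth U i (a - h),
      forall u, 0 <= u <= a - h -> depth U i (a - h) <= depth U i u &
      exists b1 b2 kappa, [/\ a < b1, b1 < b2, b2 < a + h, 0 < kappa &
        forall t, b1 <= t <= b2 -> depth U i t <= mu - kappa]].

(** The range of [h] must not depend on [mu], because the rate is minimized over [mu] at fixed [h];
    [inf_max_depth U] serves as the common upper level. *)
Lemma tame_window_near (i : R) : is_well i ->
  \forall h \near 0^'+,
    forall mu, resonance_interval U mu -> tame_window i h mu.
Proof.
move=> wi; have [[mu0 /(resonance_interval_depth wi)[mu0M D0 [t t0 Dt]]]|] :=
  pselect (exists mu, resonance_interval U mu); last first.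
  by move=> hN; apply: nearW => h mu hmu; exfalso; apply: hN; exists mu.
have cD := depth_continuous hU wi; have Dmin := depth_local_min_global wi.
have [|h0 h00 hh] := first_entrance_uniform cD D0 _ Dmin.
  by exists t => //; apply/ltW/(lt_trans Dt).
apply: filterS (near0_lt h00) => h /andP[h_gt0 hlt] mu.
move=> /(resonance_interval_depth wi)[muM _ Dmu].
have D0mu : mu < depth U i 0 by lra.
have Dmu' : exists2 t : R, 0 <= t & depth U i t <= mu.
  by case: Dmu => s s0 /ltW Ds; exists s.
have [h1 h2] := hh h mu h_gt0 hlt muM Dmu; split => //.
  have a_lt : entrance_time U mu i - h < entrance_time U mu i by lra.
  by apply: (gt_first_entrance (D := depth U i)) => //; rewrite subr_ge0 ltW.
exact: (first_entrance_dip cD D0mu Dmu' Dmin Dmu).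
Qed.

(** [M] may depend on [eps]: it only enters the choice of a grid, not the final estimates. *)
Lemma jump_rate_bounded (eps mu i b1 b2 : R) : is_well i -> 0 < eps ->
  0 <= b1 -> b1 <= b2 ->
  exists M, forall t, b1 * period eps mu <= t <= b2 * period eps mu ->
    jump_rate U eps mu i t <= M.
Proof.
move=> wi eps0 b10 b12.
have [m _ hm] := continuous_min (depth_continuous hU wi) b10 b12.
exists (expR (- depth U i m / eps)) => t ht; rewrite /jump_rate ler_expR.
rewrite ler_pM2r ?invr_gt0 // lerN2; apply: hm.
by rewrite ler_pdivlMr ?ler_pdivrMr ?expR_gt0.
Qed.

(** * Exponential rate of the chain *)

Section Chain.
Context {d : measure_display} {Omega : measurableType d}.
Variables (P : R -> R -> R -> probability Omega R).
Variables (Y : R -> R -> R -> Omega -> R).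
Hypothesis hY : forall eps mu i : R, 0 < eps -> resonance_interval U mu ->
  is_well i -> two_state_chain (P eps mu i) (Y eps mu) (jump_rate U eps mu) i.

Section Window.
Variables (h mu i : R).
Hypotheses (h0 : 0 < h) (hmu : resonance_interval U mu) (wi : is_well i).
Hypothesis tw : tame_window i h mu.
Let a := entrance_time U mu i.
Let r := mu - depth U i (a - h).

(** On [[b1 * T, b2 * T]] the jump rate is at least [expR (g / eps) / T]. The upper bound will be
    used with [g > 0] on the dip after [a], the lower one with [g < 0] just before [a - h]. *)
Lemma window_bounds (eps b1 b2 g : R) : 0 < eps ->
  0 <= b1 -> b1 < b2 ->
  (forall t, b1 <= t <= b2 -> depth U i t <= mu - g) ->
  let x := expR (- ((b2 - b1) / 2 * expR (g / eps))) in
  (b2 <= a + h -> 1 - window_probability U P Y h eps mu i <=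
     (a - h) * expR (r / eps) + x) /\
  (b2 < a - h -> 1 - x <= 1 - window_probability U P Y h eps mu i).
Proof.
move=> eps0 b10 b12 hg x; have [ha _ hmin _] := tw; rewrite -/a in ha hmin.
have [p [tp mp]] := hY eps0 hmu wi; set T := period eps mu.
have T0 : 0 < T by exact: expR_gt0.
have q0 j t : 0 <= jump_rate U eps mu j t by exact: expR_ge0.
have [M1 hM1] := jump_rate_bounded mu wi eps0 b10 (ltW b12).
have [M2 hM2] := jump_rate_bounded mu (is_wellN wi) eps0 b10 (ltW b12).
rewrite -/T in hM1 hM2.
set c := expR (- (mu - g) / eps).
have hq t : b1 * T <= t <= b2 * T -> [/\ c <= jump_rate U eps mu i t,
    jump_rate U eps mu i t <= Num.max M1 M2 &
    jump_rate U eps mu (- i) t <= Num.max M1 M2].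
  move=> ht; split; last 2 first.
  - by rewrite le_max hM1.
  - by rewrite le_max hM2 ?orbT.
  rewrite /c /jump_rate ler_expR ler_pM2r ?invr_gt0 // lerN2; apply: hg.
  by rewrite ler_pdivlMr ?ler_pdivrMr.
have xE : x = expR (- (c / 2 * (b2 * T - b1 * T))).
  rewrite /x; congr (expR (- _)).
  rewrite (_ : g / eps = - (mu - g) / eps + mu / eps); last by ring.
  by rewrite expRD -/c -/(period _ _) -/T; ring.
have bT : b1 * T < b2 * T by rewrite ltr_pM2r.
have s10 : 0 <= b1 * T by rewrite mulr_ge0 // ltW.
have t10 : 0 < (a - h) * T by rewrite mulr_gt0 // subr_gt0.
have t20 : 0 < (a + h) * T by rewrite mulr_gt0 // addr_gt0 // (lt_trans h0).
have c0 : 0 <= c by exact: expR_ge0.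
rewrite xE; split=> hb2.
  have -> : (a - h) * expR (r / eps) =
      expR (- depth U i (a - h) / eps) * ((a - h) * T).
    rewrite (_ : r / eps = - depth U i (a - h) / eps + mu / eps).
      by rewrite expRD -/(period _ _) -/T; ring.
    by rewrite /r; ring.
  apply: (window_error_le tp mp wi q0 t10 t20 s10 bT _ c0 _ hq).
    by rewrite ler_pM2r.
  move=> u /andP[u0 ut]; rewrite /jump_rate ler_expR ler_pM2r ?invr_gt0 // lerN2.
  by apply: hmin; rewrite ler_pdivrMr // ut divr_ge0 // ltW.
by apply: (window_error_ge tp mp wi q0 t10 t20 s10 bT _ c0 hq); rewrite ltr_pM2r.
Qed.

Lemma window_rate eta : 0 < eta -> \forall eps \near 0^'+,
  expR ((r - eta) / eps) <= 1 - window_probability U P Y h eps mu i <=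
  expR ((r + eta) / eps).
Proof.
move=> eta0; have [ha hr hmin [b1 [b2 [kappa [ab1 b12 b2a k0 hk]]]]] := tw.
rewrite -/a in ha hr hmin ab1 b2a.
have r0 : r < 0 by rewrite subr_lt0.
have ah0 : 0 < a - h by rewrite subr_gt0.
have Dah : depth U i (a - h) < mu - (r - eta / 2) by rewrite /r; lra.
have [e e0 he] := continuous_near_lt (depth_continuous hU wi) (ltW ah0) Dah.
(* On [[a - h - m, a - h - m / 2]], which lies in [[0, a - h[], the depth exceeds its value at
   [a - h] by less than [eta / 2]; the other half of [eta] goes to [near0_lower_rate]. *)
set m := Num.min (a - h) (e / 2).
have m0 : 0 < m by rewrite lt_min ah0 divr_gt0.
have m1 : m <= a - h by rewrite ge_min lexx.
have m2 : m <= e / 2 by rewrite ge_min lexx orbT.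
set b1' := a - h - m; set b2' := a - h - m / 2.
have hk' t : b1' <= t <= b2' -> depth U i t <= mu - (r - eta / 2).
  rewrite /b1' /b2' => ht; apply/ltW/he; first lra.
  by rewrite ltr_norml; lra.
have b1'0 : 0 <= b1' by rewrite /b1'; lra.
have b12' : b1' < b2' by rewrite /b1' /b2'; lra.
have b1_ge0 : 0 <= b1 by have := h0; lra.
have B0 : 0 < (b2 - b1) / 2 by rewrite divr_gt0 // subr_gt0.
have B0' : 0 < (b2' - b1') / 2 by rewrite divr_gt0 // subr_gt0.
have hlow : r - eta + eta / 2 = r - eta / 2 by lra.
have eta20 : 0 < eta / 2 by rewrite divr_gt0.
have hneg : r - eta + eta / 2 <= 0 by lra.
near=> eps.
have eps0 : 0 < eps by near: eps; exact: nbhs_right_gt.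
have [/(_ (ltW b2a)) up _] := window_bounds eps0 b1_ge0 b12 hk.
have [_ low] := window_bounds eps0 b1'0 b12' hk'.
have {}low := low _; apply/andP; split.
  apply: le_trans (low _); last by rewrite /b2'; lra.
  by rewrite -hlow; near: eps; exact: near0_lower_rate.
by apply: (le_trans up); near: eps; exact: near0_upper_rate.
Unshelve. all: by end_near. Qed.

End Window.

(** One minus the minimum of the two window probabilities is the larger of the two errors, and its
    exponential rate is the larger of the two rates. *)
Lemma chain_log_error_cvg (h mu : R) : 0 < h -> resonance_interval U mu ->
  tame_window 1 h mu -> tame_window (-1) h mu ->
  chain_log_error U P Y h mu eps @[eps --> 0^'+] --> diffusion_rate U h mu.
Proof.
move=> h0 hmu tw1 twN1; apply: cvg_log_rate => eta eta0.
have w1 : is_well (1 : R) by left.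
have wN1 : is_well (-1 : R) by right.
near=> eps.
have eps0 : 0 < eps by near: eps; exact: nbhs_right_gt.
have /andP[l1 u1] :
    expR ((mu - depth U 1 (entrance_time U mu 1 - h) - eta) / eps)
    <= 1 - window_probability U P Y h eps mu 1 <=
    expR ((mu - depth U 1 (entrance_time U mu 1 - h) + eta) / eps).
  by near: eps; exact: window_rate.
have /andP[l2 u2] :
    expR ((mu - depth U (-1) (entrance_time U mu (-1) - h) - eta) / eps)
    <= 1 - window_probability U P Y h eps mu (-1) <=
    expR ((mu - depth U (-1) (entrance_time U mu (-1) - h) + eta) / eps).
  by near: eps; exact: window_rate.
rewrite /diffusion_rate /chain_quality.
move: l1 u1 l2 u2; set r1 := mu - _; set r2 := mu - _.
set w1' := window_probability _ _ _ _ _ _ _.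
set w2' := window_probability _ _ _ _ _ _ _.
move=> l1 u1 l2 u2.
have mono (x y s : R) : x <= y -> expR ((x + s) / eps) <= expR ((y + s) / eps).
  by move=> xy; rewrite ler_expR ler_pM2r ?invr_gt0 // lerD2r.
apply/andP; split.
- have [r12|r21] := leP r1 r2.
    by apply: (le_trans l2); rewrite lerD2l lerN2 ge_min lexx orbT.
  by apply: (le_trans l1); rewrite lerD2l lerN2 ge_min lexx.
- have [w12|w21] := leP w1' w2'.
    by apply: (le_trans u1); apply: mono; rewrite le_max lexx.
  by apply: (le_trans u2); apply: mono; rewrite le_max lexx orbT.
Unshelve. all: by end_near. Qed.

Lemma chain_log_error_cvg_near : \forall h \near 0^'+,
  forall mu, resonance_interval U mu ->
  chain_log_error U P Y h mu eps @[eps --> 0^'+] --> diffusion_rate U h mu.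
Proof.
have w1 : is_well (1 : R) by left.
have wN1 : is_well (-1 : R) by right.
near=> h.
have h0 : 0 < h by near: h; exact: nbhs_right_gt.
have tw1 : forall mu, resonance_interval U mu -> tame_window 1 h mu.
  by near: h; exact: tame_window_near.
have twN1 : forall mu, resonance_interval U mu -> tame_window (-1) h mu.
  by near: h; exact: tame_window_near.
by move=> mu hmu; apply: chain_log_error_cvg; [|  | exact: tw1 | exact: twN1].
Unshelve. all: by end_near. Qed.

End Chain.
End Resonance.

(** * Transfer of resonance points between rates that agree on the resonance interval *)

Lemma is_resonance_point_ext (R : realType) (U : R -> R -> R)
    (rate1 rate2 : R -> R -> R) (muR : R) :
  (\forall h \near 0^'+, forall mu, resonance_interval U mu ->
     rate1 h mu = rate2 h mu) ->
  is_resonance_point U rate1 muR -> is_resonance_point U rate2 muR.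
Proof.
move=> hE [m [hm hlim hR]]; exists m; split=> //.
apply: filterS2 hE hm => h hE [Im hmin]; split=> // mu Imu.
by rewrite -!hE //; exact: hmin.
Qed.

Theorem theorem3p4 (R : realType) (U : R -> R -> R)
    (hU : double_well_potential U) (hD : depth_assumptions U)
    (d : measure_display) (Omega : measurableType d)
    (P : R -> R -> R -> probability Omega R)
    (Y : R -> R -> R -> Omega -> R)
    (hY : forall eps mu i : R, 0 < eps -> resonance_interval U mu -> is_well i ->
       two_state_chain (P eps mu i) (Y eps mu) (jump_rate U eps mu) i) :
  forall muR : R,
    diffusion_resonance_point U muR <-> chain_resonance_point U P Y muR.
Proof.
move=> muR; have hcvg := chain_log_error_cvg_near hU hD hY.
have hE : \forall h \near 0^'+, forall mu, resonance_interval U mu ->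
    chain_rate U P Y h mu = diffusion_rate U h mu.
  apply: filterS hcvg => h hh mu Imu.
  by apply: (cvg_lim (@Rhausdorff R)); exact: hh.
split=> [hdiff|[_ hchain]].
- split; first by apply: filterS hcvg => h hh mu Imu; apply/cvg_ex;
    exists (diffusion_rate U h mu); exact: hh.
  apply: is_resonance_point_ext hdiff.
  by apply: filterS hE => h hh mu Imu; rewrite hh.
- exact: is_resonance_point_ext hchain.
Qed.
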